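(* Let $\alpha$ be a positive integer, let $a,b,\beta>0$ and $x\in(0,1)$. Then $$ \frac{\phi_{a,b,\alpha,\beta}(x)}{x^{2a}(1-x)^{2b+\alpha+\beta}} =\sum_{j=0}^{\alpha-1}\frac{a\,\Gamma(a+b+j)\,\Gamma(a+b+\beta+\alpha-j-1)}{[\Gamma(a+1)]^2\,\Gamma(b+j+1)\,\Gamma(b+\beta+\alpha-j)}\,E_j(x), $$ where $$ E_j(x)=(a+b+\beta+\alpha-j-1)\,{}_2F_1(1,a+b+\beta+\alpha-j;\,a+1;\,x)-(a+b+j)\,{}_2F_1(1,a+b+j+1;\,a+1;\,x). $$
   Context: For $a,b>0$ and $x\in(0,1)$, $I_x(a,b)=\dfrac{\int_0^x t^{a-1}(1-t)^{b-1}dt}{\int_0^1 t^{a-1}(1-t)^{b-1}dt}$ is the normalized incomplete beta function. For $a,b,\alpha,\beta>0$ put $$\phi_{a,b,\alpha,\beta}(x)=I_x(a,b+\alpha)\,I_x(a,b+\beta)-I_x(a,b)\,I_x(a,b+\alpha+\beta).$$ ${}_2F_1(p,q;r;x)=\sum_{n=0}^\infty \frac{(p)_n(q)_n}{(r)_n\,n!}x^n$ is the Gauss hypergeometric function, where $(p)_0=1$ and $(p)_n=p(p+1)\cdots(p+n-1)$ is the Pochhammer symbol. *)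

(* Defs.v *)
From HB Require Import structures.
From mathcomp Require Import all_boot all_order all_algebra.
From mathcomp Require Import all_classical all_reals all_analysis.

Set Implicit Arguments.
Unset Strict Implicit.
Unset Printing Implicit Defensive.

Import Order.TTheory GRing.Theory Num.Theory.
Import numFieldNormedType.Exports.

Local Open Scope classical_set_scope.
Local Open Scope ring_scope.

(* The integrals are Lebesgue integrals over open intervals, so that
   the endpoint singularities of the integrands (where [powR] takes
   conventional values) lie outside the domain. *)

Definition Gamma {R : realType} (s : R) : R :=
  \int[lebesgue_measure]_(t in `]0, +oo[) (t `^ (s - 1) * expR (- t)).

Definition beta_integral {R : realType} (x a b : R) : R :=
  \int[lebesgue_measure]_(t in `]0, x[) (t `^ (a - 1) * (1 - t) `^ (b - 1)).

Definition regularized_beta {R : realType} (x a b : R) : R :=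
  beta_integral x a b / beta_integral 1 a b.

Definition phi {R : realType} (a b alpha beta x : R) : R :=
  regularized_beta x a (b + alpha) * regularized_beta x a (b + beta)
  - regularized_beta x a b * regularized_beta x a (b + alpha + beta).

Definition pochhammer {R : realType} (p : R) (n : nat) : R :=
  \prod_(k < n) (p + k%:R).

(* 2F1(p, q; r; x); [limn] is the value of the sum only where the series
   converges, which is the case for `|x| < 1 and r > 0. *)
Definition hyp2F1 {R : realType} (p q r x : R) : R :=
  limn (series (fun n : nat =>
    pochhammer p n * pochhammer q n / (pochhammer r n * (n`!)%:R) * x ^+ n)).

Definition Eterm {R : realType} (a b beta : R) (alpha j : nat) (x : R) : R :=
  (a + b + beta + alpha%:R - j%:R - 1)
    * hyp2F1 1 (a + b + beta + alpha%:R - j%:R) (a + 1) x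
  - (a + b + j%:R) * hyp2F1 1 (a + b + j%:R + 1) (a + 1) x.

(* Main.v *)
(** Write I(u) = I_x(a,u), u = b+j and w = b+beta+alpha-j-1. Integrating
    t^a (1-t)^u by parts gives
      I(u+1) - I(u) = x^a (1-x)^u Gamma(a+u) / (Gamma(a) Gamma(u+1)),
    and iterating a B_x(a,u) = x^a (1-x)^u + (a+u) B_x(a+1,u) gives
      I(u+1) = x^a (1-x)^(u+1) Gamma(a+u+1) / (Gamma(a+1) Gamma(u+1))
               2F1(1,a+u+1;a+1;x).
    Hence the j-th summand of the right-hand side, multiplied by
    x^(2a) (1-x)^(2b+alpha+beta), equals
      (I(u+1)-I(u)) I(w+1) - (I(w+1)-I(w)) I(u+1) = I(u+1) I(w) - I(u) I(w+1),
    and the sum over j telescopes to phi. *)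
Require Import Defs.
From HB Require Import structures.
From mathcomp Require Import all_boot all_order all_algebra.
From mathcomp Require Import all_classical all_reals all_analysis.
From mathcomp Require Import measurable_realfun ring lra.

Set Implicit Arguments.
Unset Strict Implicit.
Unset Printing Implicit Defensive.

Import Order.TTheory GRing.Theory Num.Theory.
Import numFieldNormedType.Exports.

Local Open Scope classical_set_scope.
Local Open Scope ring_scope.

(** * Affine change of variables, and integrals over open intervals by exhaustion *)

(** Lebesgue measure and [c] times its pushforward under y -> c y + d give every half-open interval
    the same length, hence coincide by uniqueness. The scaling and the translation of the gamma
    densities below are both instances. *)
Lemma ge0_integral_affine (R : realType) (c d : R) (f : R -> \bar R) :
  0 < c -> measurable_fun setT f -> (forall x, 0 <= f x)%E ->
  (\int[lebesgue_measure]_x f x =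
   c%:E * \int[lebesgue_measure]_x f (c * x + d)%R)%E.
Proof.
move=> c0 mf f0.
pose phi := fun x : measurableTypeR R => c * x + d : measurableTypeR R.
have mphi : measurable_fun setT phi.
  by apply: measurable_funD => //; apply: measurable_funM.
have [pm pmE] : {pm : {measure set (measurableTypeR R) -> \bar R} |
    pm = pushforward lebesgue_measure phi :> (set _ -> _)}.
  unshelve eexists; first by refine (pushforward lebesgue_measure phi).
  by [].
pose m := mscale (NngNum (ltW c0)) pm.
have mE X : ocitv X -> lebesgue_measure X = m X.
  move=> [[u v]/= _ <-]; rewrite /m /mscale/= pmE /pushforward.
  have -> : phi @^-1` `]u, v]%classic = `](u - d) / c, (v - d) / c]%classic.
    apply/seteqP; split => y; rewrite /phi /= !in_itv/= ltr_pdivrMr// ler_pdivlMr//;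
      by rewrite ltrBlDr lerBrDr (mulrC c).
  rewrite !lebesgue_measure_itv/= !lte_fin.
  rewrite ltr_pM2r ?invr_gt0// ltrD2r; case: ifP => _; last by rewrite mule0.
  by rewrite -!EFinB -EFinM; congr EFin; field; rewrite gt_eqF.
have -> : (\int[lebesgue_measure]_x f x = \int[m]_x f x)%E.
  apply: eq_measure_integral => A mA _.
  exact: lebesgue_measure_unique.
rewrite /m ge0_integral_mscale//=; congr (_ * _)%E.
by rewrite pmE ge0_integral_pushforward.
Qed.

(* Splitting the derivative into two nonnegative parts makes both sides
   meaningful in the extended reals, whether or not they are finite. *)
Lemma integral_derive_exhaustion (R : realType) (l r : R^nat) (A : set R)
    (F g h : R -> R) (L : R) :
  (forall n, l n < r n) -> nonincreasing_seq l -> nondecreasing_seq r ->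
  A = \bigcup_n `[l n, r n]%classic ->
  (forall t, A t -> is_derive t 1 F (g t - h t)) ->
  (forall t, A t -> {for t, continuous g}) ->
  (forall t, A t -> {for t, continuous h}) ->
  (forall t, A t -> 0 <= g t) -> (forall t, A t -> 0 <= h t) ->
  F (r n) - F (l n) @[n --> \oo] --> L ->
  (\int[lebesgue_measure]_(t in A) (g t)%:E =
   L%:E + \int[lebesgue_measure]_(t in A) (h t)%:E)%E.
Proof.
move=> lr nl nr AE dF cg ch g0 h0 FL.
pose I n := `[l n, r n]%classic.
have IA n : I n `<=` A by rewrite AE; exact: bigcup_sup.
have ndI : nondecreasing_seq I.
  move=> m n mn; rewrite subsetEset /I => t /=; rewrite !in_itv/= => /andP[lt tr].
  by rewrite (le_trans (nl _ _ mn) lt)/= (le_trans tr (nr _ _ mn)).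
have cI (k : R -> R) n : (forall t, A t -> {for t, continuous k}) ->
    {within I n, continuous k}.
  move=> ck; apply/continuous_in_subspaceT => t /set_mem It.
  exact: ck (IA n _ It).
have iI (k : R -> R) n : (forall t, A t -> {for t, continuous k}) ->
    lebesgue_measure.-integrable (I n) (EFin \o k).
  by move=> ck; apply: continuous_compact_integrable; [exact: segment_compact|exact: cI].
have mI (k : R -> R) n : (forall t, A t -> {for t, continuous k}) ->
    measurable_fun (I n) (EFin \o k).
  by move=> ck; have /integrableP[] := iI k n ck.
(* On a compact interval both integrals are finite, so the fundamental theorem for [g \- h] may be
   rearranged with [h] on the right. Monotone convergence then passes to [A] on each side
   separately. *)
have ftc n : (\int[lebesgue_measure]_(t in I n) (g t)%:E =
    (F (r n) - F (l n))%:E + \int[lebesgue_measure]_(t in I n) (h t)%:E)%E.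
  have dc t : `[l n, r n]%classic t -> {for t, continuous F}.
    move=> /IA At; apply: differentiable_continuous.
    by apply/derivable1_diffP; have [] := dF _ At.
  rewrite EFinB -(@continuous_FTC2 _ (g \- h) F) ?lr//.
  - have -> : (\int[lebesgue_measure]_(t in `[l n, r n]) ((g \- h) t)%:E =
        \int[lebesgue_measure]_(t in `[l n, r n]) ((g t)%:E - (h t)%:E))%E.
      by apply: eq_integral => t _; rewrite EFinB.
    rewrite integralB//; [|exact: iI|exact: iI].
    by rewrite subeK//; apply: integrable_fin_num => //; exact: iI.
  - by apply: cI => t At; apply: cvgB; [exact: cg|exact: ch].
  - split.
    + by move=> t /subset_itv_oo_cc It; have [] := dF _ (IA n t It).
    + apply: cvg_at_right_filter; apply: dc => /=.
      by rewrite in_itv/= lexx ltW.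
    + apply: cvg_at_left_filter; apply: dc => /=.
      by rewrite in_itv/= lexx ltW.
  - move=> t /subset_itv_oo_cc It.
    by rewrite derive1E; have [_ ->] := dF _ (IA n t It).
have cvI (k : R -> R) : (forall t, A t -> {for t, continuous k}) ->
    (forall t, A t -> 0 <= k t) ->
    (\int[lebesgue_measure]_(t in I n) (k t)%:E)%E @[n --> \oo] -->
    (\int[lebesgue_measure]_(t in A) (k t)%:E)%E.
  move=> ck k0; rewrite AE; apply: ge0_nondecreasing_set_cvg_integral => //.
  - by move=> n; exact: measurable_itv.
  - by move=> n; exact: mI.
  - by move=> n t /IA /k0; rewrite -lee_fin.
have gE := cvI _ cg g0.
rewrite (_ : (fun n => _) = (fun n => (F (r n) - F (l n))%:E +
    \int[lebesgue_measure]_(t in I n) (h t)%:E)%E) in gE; last exact/funext.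
(* The integral of [h] over [A] may be infinite; the boundary term has a finite limit, so the
   limiting sum is still well defined. *)
apply: (cvg_unique _ gE) => //; apply: cvgeD; last exact: cvI.
- by rewrite fin_num_adde_defr.
- by apply: cvg_EFin; [exact: nearW|exact: FL].
Qed.

(* Starting at 1/3 keeps [`[vanishing n, (vanishing n)^-1]] and
   [`[vanishing n, 1 - vanishing n]] nondegenerate for every [n]. *)
Definition vanishing {R : realType} (n : nat) : R := n.+3%:R^-1.

Lemma vanishing_gt0 (R : realType) n : 0 < vanishing n :> R.
Proof. by rewrite invr_gt0. Qed.

Lemma vanishing_lt (R : realType) n : vanishing n < 2^-1 :> R.
Proof. by rewrite ltf_pV2 ?posrE// ltr_nat. Qed.

Lemma vanishing_noninc (R : realType) : nonincreasing_seq (@vanishing R).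
Proof. by move=> m n mn; rewrite lef_pV2 ?posrE// ler_nat. Qed.

Lemma vanishing_ltV (R : realType) n : vanishing n < (vanishing n)^-1 :> R.
Proof.
have h := vanishing_lt R n; have h0 := vanishing_gt0 R n.
rewrite (lt_trans h)// ltf_pV2 ?posrE// (lt_trans h)//.
by rewrite invf_plt ?posrE// (@lt_trans _ _ 1) ?ltr1n// invf_lt1// ltr1n.
Qed.

Lemma vanishingV_nondec (R : realType) :
  nondecreasing_seq (fun n => (vanishing n)^-1 : R).
Proof.
by move=> m n mn; rewrite lef_pV2 ?posrE ?vanishing_gt0// vanishing_noninc.
Qed.

Lemma cvg_vanishing (R : realType) : @vanishing R n @[n --> \oo] --> 0.
Proof.
have := @cvg_harmonic R; rewrite -(cvg_shiftn 2); apply: cvg_trans.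
by apply: near_eq_cvg; near=> n; rewrite /harmonic/= /vanishing addn2.
Unshelve. all: by end_near. Qed.

Lemma vanishing_le (R : realType) (e : R) :
  0 < e -> exists N, forall n, (N <= n)%N -> vanishing n <= e.
Proof.
move=> e0; have /cvgrPdist_le /(_ _ e0)[N _ NP] := @cvg_vanishing R.
exists N => n /NP /=; rewrite sub0r normrN ger0_norm//.
exact/ltW/vanishing_gt0.
Qed.

Lemma itv0y_exhaustion (R : realType) :
  `]0, +oo[%classic = \bigcup_n `[vanishing n, (vanishing n)^-1]%classic :> set R.
Proof.
apply/seteqP; split => [t|t [n _]] /=; rewrite !in_itv/=; last first.
  by rewrite andbT => /andP[+ _]; apply: lt_le_trans; exact: vanishing_gt0.
rewrite andbT => t0.
have [M MP] := vanishing_le t0.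
have ti0 : 0 < t^-1 by rewrite invr_gt0.
have [N NP] := vanishing_le ti0.
exists (maxn M N) => //=; rewrite in_itv/= MP ?leq_maxl//=.
by rewrite -[t]invrK lef_pV2 ?posrE ?vanishing_gt0// NP// leq_maxr.
Qed.

Lemma itv0x_exhaustion (R : realType) (x : R) : 0 < x ->
  `]0, x[%classic =
  \bigcup_n `[x * vanishing n, x * (1 - vanishing n)]%classic :> set R.
Proof.
move=> x0; apply/seteqP; split => [t|t [n _]] /=; rewrite !in_itv/=; last first.
  move=> /andP[lt tr]; rewrite (lt_le_trans _ lt) ?mulr_gt0 ?vanishing_gt0//=.
  by rewrite (le_lt_trans tr)// gtr_pMr// ltrBlDr ltrDl vanishing_gt0.
move=> /andP[t0 tx].
have [M MP] := vanishing_le (divr_gt0 t0 x0).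
have tx0 : 0 < 1 - t / x by rewrite subr_gt0 ltr_pdivrMr// mul1r.
have [N NP] := vanishing_le tx0.
exists (maxn M N) => //=; rewrite in_itv/= mulrC -ler_pdivlMr// MP ?leq_maxl//=.
by rewrite mulrC -ler_pdivrMr// lerBrDl -lerBrDr NP// leq_maxr.
Qed.

(** The limit of a power at 0 is one-sided, so positivity of [f] is used to turn convergence to 0
    into convergence from the right. *)
Lemma cvg_powR0 (R : realType) (T : Type) (G : set_system T) {FG : Filter G}
    (f : T -> R) (s : R) :
  0 < s -> (\forall n \near G, 0 < f n) -> f n @[n --> G] --> 0 ->
  f n `^ s @[n --> G] --> 0.
Proof.
move=> s0 f0 fl.
have H : f n @[n --> G] --> 0^'+.
  move=> P [e /= e0 eP]; near=> n.
  apply: eP => /=; last by near: n.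
  by near: n; move/cvgrPdist_lt : fl; exact.
exact: (cvg_comp _ _ H (powR_cvg0 s0)).
Unshelve. all: by end_near. Qed.

Lemma continuous_powR_gt0 (R : realType) (s t : R) :
  0 < t -> {for t, continuous (fun t => t `^ s)}.
Proof.
move=> t0; apply: differentiable_continuous.
by apply/derivable1_diffP; have [] := is_derive1_powR s t0.
Qed.

(** * The Gamma function: finiteness, positivity, functional equation *)

(** For an integer n + 1 >= s, a single term of the exponential series gives (1+t)^s <= (1+t)^(n+1)
    <= (n+1)! e^(1+t), whence the constant (n+1)! e. *)
Lemma powR1D_expRN_bounded (R : realType) (s : R) :
  exists2 C, 0 < C & forall t, 0 <= t -> (1 + t) `^ s * expR (- t) <= C.
Proof.
pose n := Num.truncn `|s|.
exists (n.+1`!%:R * expR 1); first by rewrite mulr_gt0 ?expR_gt0// ltr0n fact_gt0.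
move=> t t0; rewrite expRN ler_pdivrMr ?expR_gt0// -mulrA -expRD.
have t1 : 0 <= 1 + t by rewrite addr_ge0.
have sn : s <= n.+1%:R.
  by rewrite (le_trans (ler_norm _))// ltW// truncnS_gt.
rewrite (le_trans (ler_powR _ sn)) ?lerDl// powR_mulrn//.
have := expR_ge1Dxn n t1.
have f0 : 0 < n.+1`!%:R :> R by rewrite ltr0n fact_gt0.
rewrite -lerBrDl ler_pdivrMr// mulrC => /le_trans; apply.
by apply: ler_wpM2l; [exact: ltW|lra].
Qed.

Lemma ge0_gamma_integrand (R : realType) (s t : R) :
  0 <= t `^ (s - 1) * expR (- t).
Proof. by rewrite mulr_ge0 ?powR_ge0 ?expR_ge0. Qed.

Lemma measurable_gamma_integrand (R : realType) (s : R) (D : set R) :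
  measurable_fun D (fun t : R => t `^ (s - 1) * expR (- t)).
Proof.
apply: (measurable_funS measurableT) => //.
apply: measurable_funM; first exact: measurable_powR.
exact: measurableT_comp.
Qed.

Lemma is_derive_ratio_powR (R : realType) (s t : R) : 0 < t ->
  is_derive t 1 (fun t => (t / (1 + t)) `^ s)
    (s * (t / (1 + t)) `^ (s - 1) * ((1 + t) ^+ 2)^-1).
Proof.
move=> t0; have t1 : 1 + t != 0 by rewrite gt_eqF// addr_gt0.
have d : is_derive t 1 (fun t : R => t / (1 + t)) ((1 + t) ^+ 2)^-1.
  have dV : is_derive t 1 (fun t : R => (1 + t)^-1) (- (1 + t) ^- 2).
    have d1 : is_derive t 1 (fun t : R => 1 + t) 1.
      have := is_deriveD (is_derive_cst (1 : R) t (1 : R)) (is_derive_id t (1 : R)).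
      by rewrite add0r.
    apply: (@is_derive_eq _ _ _ _ _ _ _ _ (is_deriveV t1 d1)).
    by rewrite /GRing.scale/= mulr1.
  apply: (@is_derive_eq _ _ _ _ _ _ _ _ (is_deriveM (is_derive_id t (1 : R)) dV)).
  by rewrite /GRing.scale/= mulr1; field.
have r0 : 0 < t / (1 + t) by rewrite divr_gt0// addr_gt0.
exact: (@is_derive1_comp _ (fun y => y `^ s) (fun t : R => t / (1 + t)) t _ _
  (is_derive1_powR s r0) d).
Qed.

Lemma measurable_powRl (R : realType) (s : R) (D : set R) (g : R -> R) :
  measurable_fun D g -> measurable_fun D (fun t => g t `^ s).
Proof. by move=> mg; exact: (measurableT_comp (measurable_powR s) mg). Qed.

(* The integrand is dominated by a multiple of [t `^ (s - 1) / (1 + t) `^ (s + 1)],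
   which has the bounded primitive [(t / (1 + t)) `^ s / s]. *)
Lemma integral_gamma_lty (R : realType) (s : R) : 0 < s ->
  (\int[lebesgue_measure]_(t in `]0%R, +oo[) (t `^ (s - 1) * expR (- t))%:E < +oo)%E.
Proof.
move=> s0; have [C C0 HC] := powR1D_expRN_bounded (s + 1).
(* This is s t^(s-1) / (1+t)^(s+1). Its primitive (t/(1+t))^s climbs from 0 to 1 on the half-line,
   so the integral of [g] is 1. *)
pose g (t : R) := s * (t / (1 + t)) `^ (s - 1) * ((1 + t) ^+ 2)^-1.
have g0 (t : R) : 0 < t -> 0 <= g t.
  by move=> t0; rewrite !mulr_ge0 ?powR_ge0 ?invr_ge0 ?sqr_ge0 ?(ltW s0).
have cg (t : R) : 0 < t -> {for t, continuous g}.
  move=> t0; have t1 : 1 + t != 0 by rewrite gt_eqF// addr_gt0.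
  have c1 : {for t, continuous (fun t : R => 1 + t)}.
    by apply: cvgD; [exact: cvg_cst|exact: cvg_id].
  apply: cvgM; last first.
    by apply: cvgV; [rewrite sqrf_eq0|apply: cvgM].
  apply: cvgM; first exact: cvg_cst.
  apply: (@continuous_comp _ _ _ (fun t : R => t / (1 + t)) (fun y => y `^ (s - 1))).
    by apply: cvgM; [exact: cvg_id|exact: cvgV].
  by apply: continuous_powR_gt0; rewrite divr_gt0// addr_gt0.
have mg : measurable_fun (`]0, +oo[%classic : set R) (EFin \o g).
  apply/measurable_EFinP; apply: open_continuous_measurable_fun => //.
  by move=> t /set_mem; rewrite /= in_itv/= andbT; exact: cg.
have ig : (\int[lebesgue_measure]_(t in `]0%R, +oo[) (g t)%:E = 1%E)%E.
  transitivity (1%:E + \int[lebesgue_measure]_(t in `]0%R, +oo[) (cst 0 t : R)%:E)%E.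
    2: by rewrite integral0 adde0.
  apply: (@integral_derive_exhaustion _ vanishing (fun n => (vanishing n)^-1) _
    (fun t => (t / (1 + t)) `^ s) g (cst 0) 1 _ _ _ (@itv0y_exhaustion R)).
  - exact: vanishing_ltV.
  - exact: vanishing_noninc.
  - exact: vanishingV_nondec.
  - move=> t; rewrite /= in_itv/= andbT => t0.
    by rewrite subr0; exact: is_derive_ratio_powR.
  - by move=> t; rewrite /= in_itv/= andbT; exact: cg.
  - by move=> t _; exact: cvg_cst.
  - by move=> t; rewrite /= in_itv/= andbT; exact: g0.
  - by [].
  - have lV n : (vanishing n)^-1 / (1 + (vanishing n)^-1) = 1 / (1 + vanishing n) :> R.
      by field; rewrite !gt_eqF ?addr_gt0 ?vanishing_gt0.
    under eq_fun do rewrite lV.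
    suff : ((1 / (1 + vanishing n)) `^ s - (vanishing n / (1 + vanishing n)) `^ s : R)
      @[n --> \oo] --> (1 - 0 : R) by rewrite subr0.
    apply: cvgB.
    + have l1 : (1 / (1 + vanishing n) : R) @[n --> \oo] --> (1 / (1 + 0) : R).
        apply: cvgM; first exact: cvg_cst.
        apply: cvgV; first by rewrite addr0 oner_eq0.
        by apply: cvgD; [exact: cvg_cst|exact: cvg_vanishing].
      have c1 : y `^ s @[y --> (1 / (1 + 0) : R)] --> (1 : R).
        have := @continuous_powR_gt0 _ s (1 / (1 + 0) : R).
        by rewrite addr0 divr1 => /(_ ltr01); rewrite /prop_for /continuous_at powR1.
      exact: (cvg_comp _ _ l1 c1).
    + apply: cvg_powR0 => //.
        by near=> n; rewrite divr_gt0// ?addr_gt0 ?vanishing_gt0.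
      suff : (vanishing n / (1 + vanishing n) : R) @[n --> \oo] --> (0 / (1 + 0) : R).
        by rewrite mul0r.
      apply: cvgM; first exact: cvg_vanishing.
      apply: cvgV; first by rewrite addr0 oner_eq0.
      by apply: cvgD; [exact: cvg_cst|exact: cvg_vanishing].
(* The bound [HC] reads e^(-t) <= C / (1+t)^(s+1); multiplying by t^(s-1) yields the majorant (C/s)
   g(t). *)
apply: (@le_lt_trans _ _ (\int[lebesgue_measure]_(t in `]0%R, +oo[) ((C / s)%:E * (g t)%:E))%E).
  apply: ge0_le_integral => //.
  - by move=> t _; rewrite lee_fin ge0_gamma_integrand.
  - by apply/measurable_EFinP; exact: measurable_gamma_integrand.
  - exact: emeasurable_funM.
  - move=> t; rewrite /= in_itv/= andbT => t0; rewrite -EFinM lee_fin.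
    have t1 : 0 < 1 + t by rewrite addr_gt0.
    have := HC _ (ltW t0); rewrite [s + 1](_ : _ = s - 1 + 2%:R); last by ring.
    rewrite powRD ?(gt_eqF t1) ?implybT// powR_mulrn ?(ltW t1)// => HC'.
    rewrite /g powRM ?(ltW t0) ?invr_ge0 ?(ltW t1)// -(powR_inv1 (ltW t1)).
    rewrite -powRrM mulN1r powRN.
    have p0 : 0 < (1 + t) `^ (s - 1) by rewrite powR_gt0.
    rewrite [leRHS](_ : _ = t `^ (s - 1) * (C / ((1 + t) `^ (s - 1) * (1 + t) ^+ 2))); last first.
      by field; rewrite !gt_eqF.
    apply: ler_wpM2l; first exact: powR_ge0.
    by rewrite ler_pdivlMr ?mulr_gt0 ?exprn_gt0// mulrC.
rewrite ge0_integralZl//=.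
- by rewrite ig mule1 ltry.
- by move=> t; rewrite /= in_itv/= andbT => t0; rewrite lee_fin g0.
- by rewrite lee_fin ltW// divr_gt0.
Unshelve. all: by end_near. Qed.

(** A real-valued integral is the [fine] part of an extended one, which would send an infinite value
    to 0. Finiteness makes the two agree, so later arguments can run in the extended reals. *)
Lemma GammaE (R : realType) (s : R) : 0 < s ->
  ((Gamma s)%:E =
   \int[lebesgue_measure]_(t in `]0%R, +oo[) (t `^ (s - 1) * expR (- t))%:E)%E.
Proof.
move=> s0; rewrite /Gamma /Rintegral fineK// ge0_fin_numE ?integral_gamma_lty//.
by apply: integral_ge0 => t _; rewrite lee_fin ge0_gamma_integrand.
Qed.

Lemma Gamma_gt0 (R : realType) (s : R) : 0 < s -> 0 < Gamma s.
Proof.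
move=> s0; rewrite -lte_fin GammaE//.
(* On [1, 2] one has 0 <= ln t <= 1, so t^(s-1) >= exp(-|s-1|), while e^(-t) >= exp(-2). *)
pose c := expR (- `|s - 1| - 2%:R).
apply: (@lt_le_trans _ _ (\int[lebesgue_measure]_(t in `[1%R, 2%R]) c%:E)%E).
  rewrite integral_cst//= lebesgue_measure_itv/= lte_fin ltr1n/= -EFinB -EFinM.
  by rewrite lte_fin mulr_gt0 ?expR_gt0// subr_gt0 ltr1n.
apply: (@le_trans _ _
  (\int[lebesgue_measure]_(t in `[1%R, 2%R]) (t `^ (s - 1) * expR (- t))%:E)%E).
  apply: ge0_le_integral => //.
  - by move=> t _; rewrite lee_fin expR_ge0.
  - by apply/measurable_EFinP; exact: measurable_gamma_integrand.
  move=> t; rewrite /= in_itv/= => /andP[t1 t2]; rewrite lee_fin.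
  have t0 : 0 < t by rewrite (lt_le_trans ltr01).
  rewrite /powR gt_eqF// -expRD ler_expR.
  have l0 : 0 <= ln t by rewrite ln_ge0.
  have l1 : ln t <= 1.
    by have := @le_ln1Dx R (t - 1); rewrite [1 + _]addrC subrK; lra.
  have := ler_norm (- (s - 1)); rewrite normrN => h.
  have : - `|s - 1| * ln t <= (s - 1) * ln t by apply: ler_wpM2r => //; lra.
  have : `|s - 1| * ln t <= `|s - 1| by apply: ler_piMr.
  by lra.
apply: ge0_subset_integral => //.
- by apply/measurable_EFinP; exact: measurable_gamma_integrand.
- by move=> t _; rewrite lee_fin ge0_gamma_integrand.
- by move=> t; rewrite /= !in_itv/= andbT => /andP[t1 _]; rewrite (lt_le_trans ltr01).
Qed.

(** Integration by parts with primitive t^s e^(-t), whose boundary values vanish at both ends. *)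
Lemma GammaS (R : realType) (s : R) : 0 < s -> Gamma (s + 1) = s * Gamma s.
Proof.
move=> s0; apply: EFin_inj; rewrite EFinM !GammaE ?addr_gt0// addrK.
have [C C0 HC] := powR1D_expRN_bounded (s + 1).
rewrite -ge0_integralZl//=; last first.
- by rewrite lee_fin ltW.
- by move=> t _; rewrite lee_fin ge0_gamma_integrand.
- by apply/measurable_EFinP; exact: measurable_gamma_integrand.
under [RHS]eq_integral do rewrite -EFinM.
rewrite -[LHS]add0e; symmetry.
have cE (t : R) : {for t, continuous (fun t => expR (- t))}.
  apply: (@continuous_comp _ _ _ -%R expR); first exact: continuousN.
  exact: continuous_expR.
apply: (@integral_derive_exhaustion _ vanishing (fun n => (vanishing n)^-1) _
    (fun t => t `^ s * expR (- t)) _ _ 0 _ _ _ (@itv0y_exhaustion R)).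
- exact: vanishing_ltV.
- exact: vanishing_noninc.
- exact: vanishingV_nondec.
- move=> t; rewrite /= in_itv/= andbT => t0.
  have dE : is_derive t 1 (fun t => expR (- t)) (expR (- t) * -1).
    exact: (@is_derive1_comp _ expR -%R).
  apply: (@is_derive_eq _ _ _ _ _ _ _ _ (is_deriveM (is_derive1_powR s t0) dE)).
  by rewrite /GRing.scale/=; ring.
- move=> t; rewrite /= in_itv/= andbT => t0.
  apply: cvgM; first exact: cvg_cst.
  by apply: cvgM; [exact: continuous_powR_gt0|exact: cE].
- move=> t; rewrite /= in_itv/= andbT => t0.
  by apply: cvgM; [exact: continuous_powR_gt0|exact: cE].
- by move=> t _; rewrite mulr_ge0 ?ge0_gamma_integrand ?ltW.
- by move=> t _; rewrite mulr_ge0 ?powR_ge0 ?expR_ge0.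
- suff : ((vanishing n)^-1 `^ s * expR (- (vanishing n)^-1)
      - vanishing n `^ s * expR (- vanishing n) : R) @[n --> \oo] --> (0 - 0 : R).
    by rewrite subr0.
  apply: cvgB.
    (* Upper end: with t the inverse of [vanishing n], the bound t^(s+1) e^(-t) <= (1+t)^(s+1)
       e^(-t) <= C gives t^s e^(-t) <= C / t. *)
    apply: (@squeeze_cvgr _ _ _ _ (fun=> 0) (fun n => C * vanishing n)).
    + near=> n; have v0 := vanishing_gt0 R n.
      rewrite mulr_ge0 ?powR_ge0 ?expR_ge0//=.
      rewrite -ler_pdivrMr// mulrAC.
      have vi0 : 0 < (vanishing n)^-1 :> R by rewrite invr_gt0.
      apply: le_trans (HC _ (ltW vi0)); apply: ler_wpM2r; first exact: expR_ge0.
      rewrite -[X in _ * X](powRr1 (ltW vi0)) -powRD ?(gt_eqF vi0) ?implybT//.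
      apply: ge0_ler_powR; rewrite ?nnegrE ?lerDr ?addr_ge0 ?(ltW vi0)//.
      by rewrite ltW.
    + exact: cvg_cst.
    + suff : (C * vanishing n : R) @[n --> \oo] --> C * 0 by rewrite mulr0.
      by apply: cvgM; [exact: cvg_cst|exact: cvg_vanishing].
  suff : (vanishing n `^ s * expR (- vanishing n) : R) @[n --> \oo] --> (0 * expR (- 0) : R).
    by rewrite mul0r.
  apply: cvgM.
    apply: cvg_powR0 => //; last exact: cvg_vanishing.
    by near=> n; exact: vanishing_gt0.
  by apply: (cvg_comp _ _ (@cvg_vanishing R) (cE 0)).
Unshelve. all: by end_near. Qed.

(** * The complete beta integral as a quotient of Gamma values *)

(** The gamma density without its normalizing constant, extended by zero so that convolution and
    translation take place on the whole line. *)
Definition gamma_density {R : realType} (s : R) : R -> \bar R :=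
  (fun t => (t `^ (s - 1) * expR (- t))%:E) \_ `]0, +oo[%classic.

Definition beta_density {R : realType} (a b : R) : R -> \bar R :=
  (fun t => (t `^ (a - 1) * (1 - t) `^ (b - 1))%:E) \_ `]0, 1[%classic.

Lemma gamma_densityE (R : realType) (s t : R) :
  gamma_density s t = if 0 < t then (t `^ (s - 1) * expR (- t))%:E else 0%E.
Proof.
rewrite /gamma_density patchE; case: ifPn => [/set_mem|/negP]; rewrite ?inE/= in_itv/= andbT.
  by move=> ->.
by move=> /negP/negbTE ->.
Qed.

Lemma beta_densityE (R : realType) (a b t : R) :
  beta_density a b t =
  if 0 < t < 1 then (t `^ (a - 1) * (1 - t) `^ (b - 1))%:E else 0%E.
Proof.
rewrite /beta_density patchE; case: ifPn => [/set_mem|/negP]; rewrite ?inE/= in_itv/=.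
  by move=> ->.
by move=> /negP/negbTE ->.
Qed.

Lemma gamma_density_ge0 (R : realType) (s t : R) : (0 <= gamma_density s t)%E.
Proof. by rewrite gamma_densityE; case: ifP => // _; rewrite lee_fin ge0_gamma_integrand. Qed.

Lemma beta_density_ge0 (R : realType) (a b t : R) : (0 <= beta_density a b t)%E.
Proof.
by rewrite beta_densityE; case: ifP => // _; rewrite lee_fin mulr_ge0 ?powR_ge0.
Qed.

Lemma measurable_gamma_density (R : realType) (s : R) :
  measurable_fun setT (gamma_density s).
Proof.
apply: (measurable_restrictT _ _).1 => //.
by apply/measurable_EFinP; exact: measurable_gamma_integrand.
Qed.

Lemma measurable_beta_integrand (R : realType) (a b : R) (D : set R) :
  measurable_fun D (fun t : R => t `^ (a - 1) * (1 - t) `^ (b - 1)).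
Proof.
apply: (measurable_funS measurableT) => //.
apply: measurable_funM; first exact: measurable_powR.
by apply: measurable_powRl; exact: measurable_funB.
Qed.

Lemma measurable_beta_density (R : realType) (a b : R) :
  measurable_fun setT (beta_density a b).
Proof.
apply: (measurable_restrictT _ _).1 => //.
by apply/measurable_EFinP; exact: measurable_beta_integrand.
Qed.

Lemma integral_gamma_density (R : realType) (s : R) : 0 < s ->
  (\int[lebesgue_measure]_t gamma_density s t = (Gamma s)%:E)%E.
Proof. by move=> s0; rewrite GammaE// [RHS]integral_mkcond. Qed.

(* Scaling [s = r u]. *)
Lemma gamma_density_convolution (R : realType) (a b r : R) :
  (\int[lebesgue_measure]_s (gamma_density a s * gamma_density b (r - s)%R) =
   gamma_density (a + b) r * \int[lebesgue_measure]_u beta_density a b u)%E.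
Proof.
have [r0|r0] := leP r 0.
  (* For r <= 0, [s] and [r - s] are never both positive, so both sides vanish. *)
  rewrite gamma_densityE ltNge r0/= mul0e.
  under eq_integral => s _.
    rewrite (_ : (gamma_density a s * _)%E = 0%E); last first.
      rewrite !gamma_densityE; case: ltP => s0; last by rewrite mul0e.
      by rewrite ltNge (_ : r - s <= 0) ?mule0//; lra.
    over.
  by rewrite integral0.
rewrite (@ge0_integral_affine _ r 0)//; last 2 first.
- apply: emeasurable_funM; first exact: measurable_gamma_density.
  apply: (measurableT_comp (measurable_gamma_density b)).
  exact: measurable_funB.
- by move=> s; rewrite mule_ge0 ?gamma_density_ge0.
rewrite -[RHS]ge0_integralZl//; last 3 first.
- exact: measurable_beta_density.
- by move=> u _; exact: beta_density_ge0.
- exact: gamma_density_ge0.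
rewrite -ge0_integralZl//; last 3 first.
- apply: emeasurable_funM.
    apply: (measurableT_comp (measurable_gamma_density a)).
    by apply: measurable_funD => //; exact: measurable_funM.
  apply: (measurableT_comp (measurable_gamma_density b)).
  by apply: measurable_funB => //; apply: measurable_funD => //; exact: measurable_funM.
- by move=> u _; rewrite mule_ge0 ?gamma_density_ge0.
- by rewrite lee_fin ltW.
apply: eq_integral => u _; rewrite !gamma_densityE beta_densityE addr0 r0.
rewrite pmulr_rgt0// (_ : (0 < r - r * u) = (u < 1)); last first.
  by rewrite subr_gt0 gtr_pMr.
case: ltP => u0; last by rewrite mul0e !mule0.
case: ltP => u1; last by rewrite !mule0.
rewrite -!EFinM; congr EFin.
have u1' : 0 <= 1 - u by rewrite subr_ge0 ltW.
rewrite (_ : r - r * u = r * (1 - u)); last by ring.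
rewrite (@powRM _ r u) ?(ltW r0) ?(ltW u0)// (@powRM _ r (1 - u)) ?(ltW r0)//.
(* The last factor [r] is the Jacobian of the scaling. *)
have -> : r `^ (a + b - 1) = r `^ (a - 1) * r `^ (b - 1) * r.
  rewrite (_ : a + b - 1 = (a - 1) + (b - 1) + 1); last by ring.
  rewrite (@powRD _ r (a - 1 + (b - 1)) 1) ?(gt_eqF r0) ?implybT// powRr1 ?ltW//.
  by rewrite (@powRD _ r (a - 1) (b - 1)) ?(gt_eqF r0) ?implybT.
rewrite (_ : expR (- r) = expR (- (r * u)) * expR (- (r * (1 - u)))); last first.
  by rewrite -expRD; congr expR; ring.
by ring.
Qed.

(* Integrating the convolution of the gamma densities in the other order
   gives [Gamma a * Gamma b], by translation invariance. *)
Lemma integral_beta_density (R : realType) (a b : R) : 0 < a -> 0 < b ->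
  (\int[lebesgue_measure]_u beta_density a b u =
   (Gamma a * Gamma b / Gamma (a + b))%:E)%E.
Proof.
move=> a0 b0.
have ab0 : 0 < a + b by rewrite addr_gt0.
have G0 := Gamma_gt0 ab0.
suff : ((Gamma a * Gamma b)%:E =
    (Gamma (a + b))%:E * \int[lebesgue_measure]_u beta_density a b u)%E.
  (* Finiteness of the beta integral is not assumed: it follows on dividing by the nonzero real
     [Gamma (a + b)]. *)
  move=> H; rewrite mulrC EFinM H muleA -EFinM mulVf ?gt_eqF// mul1e//.
transitivity (\int[lebesgue_measure]_s (gamma_density a s * (Gamma b)%:E))%E.
  rewrite [RHS]ge0_integralZr; [|by []| | |].
  - by rewrite (integral_gamma_density a0) -EFinM.
  - exact: measurable_gamma_density.
  - by move=> s _; exact: gamma_density_ge0.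
  - by rewrite lee_fin; exact/ltW/Gamma_gt0.
transitivity (\int[lebesgue_measure]_s \int[lebesgue_measure]_r
    (gamma_density a s * gamma_density b (r - s)%R))%E.
  apply: eq_integral => s _.
  rewrite [RHS]ge0_integralZl//; last 3 first.
  - apply: (measurableT_comp (measurable_gamma_density b)).
    exact: measurable_funB.
  - by move=> r _; exact: gamma_density_ge0.
  - exact: gamma_density_ge0.
  congr (_ * _)%E.
    transitivity (\int[lebesgue_measure]_t gamma_density b t)%E.
      by rewrite (integral_gamma_density b0).
    rewrite [LHS](@ge0_integral_affine _ 1 (- s))//.
  - by rewrite mul1e; apply: eq_integral => r _; rewrite mul1r.
  - exact: measurable_gamma_density.
  - by move=> t; exact: gamma_density_ge0.
rewrite (@fubini_tonelli _ _ _ _ R lebesgue_measure lebesgue_measure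
  (fun z : R * R => gamma_density a z.1 * gamma_density b (z.2 - z.1)%R)%E)/=.
- under eq_integral do rewrite gamma_density_convolution.
  rewrite [LHS]ge0_integralZr//.
  + by rewrite (integral_gamma_density ab0).
  + exact: measurable_gamma_density.
  + by move=> s _; exact: gamma_density_ge0.
  + by apply: integral_ge0 => s _; exact: beta_density_ge0.
- apply: emeasurable_funM.
    exact: (measurableT_comp (measurable_gamma_density a)).
  apply: (measurableT_comp (measurable_gamma_density b)).
  exact: measurable_funB.
- by move=> z; rewrite mule_ge0 ?gamma_density_ge0.
Qed.

Lemma beta_integral1E (R : realType) (a b : R) : 0 < a -> 0 < b ->
  beta_integral 1 a b = Gamma a * Gamma b / Gamma (a + b).
Proof.
move=> a0 b0; rewrite /beta_integral /Rintegral integral_mkcond.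
by rewrite -/(beta_density a b) integral_beta_density.
Qed.

(** * Recurrences for the incomplete beta integral *)

(** The closed form of the complete integral is finite, which gives integrability on ]0,
    1[ and, by restriction, on ]0, x[. *)
Lemma beta_integrable (R : realType) (x a b : R) : 0 < a -> 0 < b -> x <= 1 ->
  lebesgue_measure.-integrable `]0, x[
    (EFin \o (fun t => t `^ (a - 1) * (1 - t) `^ (b - 1))).
Proof.
move=> a0 b0 x1; apply: (@integrableS _ _ R lebesgue_measure (`]0, 1[%classic : set R)) => //.
  by apply: subset_itvl; rewrite bnd_simp.
apply/integrableP; split.
  by apply/measurable_EFinP; exact: measurable_beta_integrand.
rewrite [ltLHS](_ : _ = \int[lebesgue_measure]_t beta_density a b t)%E.
  by rewrite integral_beta_density// ltry.
rewrite integral_mkcond; apply: eq_integral => t _.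
rewrite /beta_density !patchE; case: ifPn => //= _.
by rewrite ger0_norm// mulr_ge0 ?powR_ge0.
Qed.

Lemma beta_integralE (R : realType) (x a b : R) : 0 < a -> 0 < b -> x <= 1 ->
  ((beta_integral x a b)%:E = \int[lebesgue_measure]_(t in `]0%R, x[)
    (t `^ (a - 1) * (1 - t) `^ (b - 1))%:E)%E.
Proof.
move=> a0 b0 x1; rewrite /beta_integral /Rintegral fineK//.
by apply: integrable_fin_num => //; exact: beta_integrable.
Qed.

(** Multiply the integrand by t + (1 - t) = 1. *)
Lemma beta_integralD1 (R : realType) (x a b : R) : 0 < a -> 0 < b -> x <= 1 ->
  beta_integral x a b = beta_integral x (a + 1) b + beta_integral x a (b + 1).
Proof.
move=> a0 b0 x1; rewrite /beta_integral -RintegralD//; last 2 first.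
- by apply: beta_integrable => //; rewrite addr_gt0.
- by apply: beta_integrable => //; rewrite addr_gt0.
apply: eq_Rintegral => t; rewrite inE/= in_itv/= => /andP[t0 tx].
have t1 : 0 < 1 - t by rewrite subr_gt0 (lt_le_trans tx).
rewrite !addrK -(mulr_powRB1 (ltW t0) a0) -(mulr_powRB1 (ltW t1) b0).
by ring.
Qed.

Lemma beta_integral_ge0 (R : realType) (x a b : R) : 0 <= beta_integral x a b.
Proof. by apply: Rintegral_ge0 => t _; rewrite mulr_ge0 ?powR_ge0. Qed.

(** The factor (1-t)^(b-1) is at most 1 when 1 <= b. This controls the remainder of the
    hypergeometric expansion. *)
Lemma le_beta_integral (R : realType) (x a b : R) : 0 < a -> 1 <= b -> x <= 1 ->
  beta_integral x a b <= beta_integral x a 1.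
Proof.
move=> a0 b1 x1; apply: le_Rintegral => //.
- by apply: beta_integrable => //; rewrite (lt_le_trans ltr01).
- exact: beta_integrable.
move=> t; rewrite /= in_itv/= => /andP[t0 tx].
rewrite subrr powRr0 ler_wpM2l ?powR_ge0//.
have t1 : 0 < 1 - t by rewrite subr_gt0 (lt_le_trans tx).
rewrite -[leRHS](powRr0 (1 - t)); apply: ger_powR; last by rewrite subr_ge0.
by rewrite t1/= gerBl ltW.
Qed.

Lemma is_derive_beta (R : realType) (a u t : R) : 0 < t -> t < 1 ->
  is_derive t 1 (fun t => t `^ a * (1 - t) `^ u)
    (a * (t `^ (a - 1) * (1 - t) `^ u) - u * (t `^ a * (1 - t) `^ (u - 1))).
Proof.
move=> t0 t1; have t1' : 0 < 1 - t by rewrite subr_gt0.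
have d1 : is_derive t 1 (fun t : R => 1 - t) (-1).
  have := is_deriveB (is_derive_cst (1 : R) t (1 : R)) (is_derive_id t (1 : R)).
  by rewrite sub0r.
have d2 := @is_derive1_comp _ (fun y => y `^ u) (fun t : R => 1 - t) t _ _
  (is_derive1_powR u t1') d1.
apply: (@is_derive_eq _ _ _ _ _ _ _ _ (is_deriveM (is_derive1_powR a t0) d2)).
by rewrite /GRing.scale/=; ring.
Qed.

Lemma beta_integral_by_parts (R : realType) (x a u : R) :
  0 < a -> 0 <= u -> 0 < x -> x < 1 ->
  a * beta_integral x a (u + 1) =
  x `^ a * (1 - x) `^ u + u * beta_integral x (a + 1) u.
Proof.
move=> a0 u0 x0 x1; apply: EFin_inj.
have c1 (s t : R) : t < 1 -> {for t, continuous (fun t : R => (1 - t) `^ s)}.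
  move=> t1; apply: (@continuous_comp R R R (fun t : R => 1 - t) (fun y => y `^ s)).
    by apply: cvgB; [exact: cvg_cst|exact: cvg_id].
  by apply: continuous_powR_gt0; rewrite subr_gt0.
have E : (\int[lebesgue_measure]_(t in `]0%R, x[) (a * (t `^ (a - 1) * (1 - t) `^ u))%:E
    = (x `^ a * (1 - x) `^ u)%:E
    + \int[lebesgue_measure]_(t in `]0%R, x[) (u * (t `^ a * (1 - t) `^ (u - 1)))%:E)%E.
  apply: (@integral_derive_exhaustion _ (fun n => x * vanishing n)
    (fun n => x * (1 - vanishing n)) _ (fun t => t `^ a * (1 - t) `^ u) _ _ _
    _ _ _ (itv0x_exhaustion x0)).
  - move=> n; rewrite ltr_pM2l//; have := vanishing_lt R n; lra.
  - by move=> m n mn; rewrite ler_pM2l// vanishing_noninc.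
  - by move=> m n mn; rewrite ler_pM2l// lerB// vanishing_noninc.
  - move=> t; rewrite /= in_itv/= => /andP[t0 tx].
    by apply: is_derive_beta => //; exact: lt_trans x1.
  - move=> t; rewrite /= in_itv/= => /andP[t0 tx].
    apply: cvgM; first exact: cvg_cst.
    by apply: cvgM; [exact: continuous_powR_gt0|apply: c1; exact: lt_trans x1].
  - move=> t; rewrite /= in_itv/= => /andP[t0 tx].
    apply: cvgM; first exact: cvg_cst.
    by apply: cvgM; [exact: continuous_powR_gt0|apply: c1; exact: lt_trans x1].
  - by move=> t _; rewrite !mulr_ge0 ?powR_ge0// ltW.
  - by move=> t _; rewrite !mulr_ge0 ?powR_ge0.
  - suff : ((x * (1 - vanishing n)) `^ a * (1 - x * (1 - vanishing n)) `^ u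
        - (x * vanishing n) `^ a * (1 - x * vanishing n) `^ u : R)
        @[n --> \oo] --> (x `^ a * (1 - x) `^ u - 0 * (1 - 0) `^ u : R).
      by rewrite mul0r subr0.
    have lr : (x * (1 - vanishing n) : R) @[n --> \oo] --> x.
      suff : (x * (1 - vanishing n) : R) @[n --> \oo] --> (x * (1 - 0) : R).
        by rewrite subr0 mulr1.
      apply: cvgM; first exact: cvg_cst.
      by apply: cvgB; [exact: cvg_cst|exact: cvg_vanishing].
    have ll : (x * vanishing n : R) @[n --> \oo] --> (0 : R).
      suff : (x * vanishing n : R) @[n --> \oo] --> (x * 0 : R) by rewrite mulr0.
      by apply: cvgM; [exact: cvg_cst|exact: cvg_vanishing].
    apply: cvgB; apply: cvgM.
    + exact: (cvg_comp _ _ lr (@continuous_powR_gt0 _ a _ x0)).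
    + exact: (cvg_comp _ _ lr (c1 u x x1)).
    + apply: cvg_powR0 => //.
      by near=> n; rewrite mulr_gt0// vanishing_gt0.
    + exact: (cvg_comp _ _ ll (c1 u 0 ltr01)).
have u1 : 0 < u + 1 by rewrite ltr_wpDl.
rewrite EFinM EFinD [X in (_ + X)%E]EFinM (beta_integralE a0 u1 (ltW x1)).
rewrite -[LHS]ge0_integralZl//; last 3 first.
- by apply/measurable_EFinP; exact: measurable_beta_integrand.
- by move=> t _; rewrite lee_fin mulr_ge0 ?powR_ge0.
- by rewrite lee_fin ltW.
rewrite addrK.
under eq_integral do rewrite -EFinM.
rewrite E; congr (_ + _)%E.
(* At [u = 0] the integral on the right has second parameter 0, outside the range of
   [beta_integralE]; the factor [u] annihilates it on both sides. *)
have [->|un0] := eqVneq u 0.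
  rewrite mul0e; under eq_integral do rewrite mul0r.
  by rewrite integral0.
have up : 0 < u by rewrite lt_neqAle eq_sym un0.
rewrite beta_integralE ?(ltW x1) ?addr_gt0//.
rewrite -[RHS]ge0_integralZl; [|by []| | |by rewrite lee_fin].
- by rewrite addrK; apply: eq_integral => t _; rewrite -EFinM.
- by apply/measurable_EFinP; exact: measurable_beta_integrand.
- by move=> t _; rewrite lee_fin mulr_ge0 ?powR_ge0.
Unshelve. all: by end_near. Qed.

(** Integration by parts, with [beta_integral x a (u + 1)] eliminated through [beta_integralD1]. *)
Lemma beta_integral_raise_a (R : realType) (x a u : R) :
  0 < a -> 0 < u -> 0 < x -> x < 1 ->
  a * beta_integral x a u =
  x `^ a * (1 - x) `^ u + (a + u) * beta_integral x (a + 1) u.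
Proof.
move=> a0 u0 x0 x1; have := beta_integral_by_parts a0 (ltW u0) x0 x1.
by rewrite (beta_integralD1 a0 u0 (ltW x1)) mulrDr => ->; ring.
Qed.

(** Eliminating [beta_integral x (a + 1) u] instead gives (a+u) B_x(a,u+1) = x^a (1-x)^u + u
    B_x(a,u). The complete integrals satisfy B(a,u+1) = B(a,u) u/(a+u), so the last term normalizes
    to exactly I_x(a,u). *)
Lemma regularized_beta_step (R : realType) (x a u : R) :
  0 < a -> 0 < u -> 0 < x -> x < 1 ->
  regularized_beta x a (u + 1) = regularized_beta x a u +
    x `^ a * (1 - x) `^ u * (Gamma (a + u) / (Gamma a * Gamma (u + 1))).
Proof.
move=> a0 u0 x0 x1; rewrite /regularized_beta !beta_integral1E ?addr_gt0//.
have au0 : 0 < a + u by rewrite addr_gt0.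
rewrite addrA !GammaS//.
have := beta_integral_by_parts a0 (ltW u0) x0 x1.
have -> : beta_integral x (a + 1) u = beta_integral x a u - beta_integral x a (u + 1).
  by rewrite (beta_integralD1 a0 u0 (ltW x1)) addrK.
set B1 := beta_integral x a (u + 1); set B := beta_integral x a u => H.
have {}H : B1 = (x `^ a * (1 - x) `^ u + u * B) / (a + u).
  apply: (mulIf (lt0r_neq0 au0)); rewrite mulfVK ?gt_eqF//.
  by rewrite [B1 * _]mulrC mulrDl H; ring.
rewrite {}H; have := Gamma_gt0 a0; have := Gamma_gt0 u0; have := Gamma_gt0 au0.
move: (Gamma a) (Gamma u) (Gamma (a + u)) (x `^ a * _) B => Ga Gu Gau X B' ? ? ?.
by field; rewrite !gt_eqF.
Qed.

(** * Pochhammer symbols and the hypergeometric expansion *)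

Lemma pochhammerS (R : realType) (p : R) n :
  pochhammer p n.+1 = pochhammer p n * (p + n%:R).
Proof. by rewrite /pochhammer big_ord_recr. Qed.

Lemma pochhammerSl (R : realType) (p : R) n :
  pochhammer p n.+1 = p * pochhammer (p + 1) n.
Proof.
rewrite /pochhammer big_ord_recl addr0; congr (_ * _).
by apply: eq_bigr => i _; rewrite lift0 -addrA -nat1r.
Qed.

Lemma pochhammer_gt0 (R : realType) (p : R) n : 0 < p -> 0 < pochhammer p n.
Proof. by move=> p0; apply: prodr_gt0 => i _; rewrite ltr_wpDr. Qed.

Lemma pochhammer1 (R : realType) n : pochhammer 1 n = n`!%:R :> R.
Proof.
elim: n => [|n IH]; first by rewrite /pochhammer big_ord0.
by rewrite pochhammerS IH factS natrM nat1r mulrC.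
Qed.

(** Iterate [beta_integral_raise_a] from [a] up to [a + n]; what is left over is an explicit
    remainder. *)
Lemma beta_integral_partial_sum (R : realType) (x a u : R) n :
  0 < a -> 0 < u -> 0 < x -> x < 1 ->
  beta_integral x a u =
  x `^ a * (1 - x) `^ u / a *
    \sum_(0 <= k < n) (pochhammer (a + u) k / pochhammer (a + 1) k * x ^+ k)
  + pochhammer (a + u) n / pochhammer a n * beta_integral x (a + n%:R) u.
Proof.
move=> a0 u0 x0 x1; elim: n => [|n IH].
  by rewrite big_nil mulr0 add0r /pochhammer !big_ord0 divr1 mul1r addr0.
have an0 : 0 < a + n%:R by rewrite ltr_wpDr.
have := beta_integral_raise_a an0 u0 x0 x1.
rewrite (_ : a + n%:R + 1 = a + n.+1%:R); last by rewrite -addrA natr1.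
move=> /(canRL (mulKf (lt0r_neq0 an0))) Bn.
have xan : x `^ (a + n%:R) = x `^ a * x ^+ n.
  by rewrite powRD ?(gt_eqF x0) ?implybT// powR_mulrn ?(ltW x0).
have p0 := pochhammer_gt0 n a0.
have a10 : 0 < a + 1 by rewrite addr_gt0.
have p1 := pochhammer_gt0 n a10.
(* Peeling the first or the last factor off (a)_(n+1) converts (a)_n into (a+1)_n, the denominator
   in the series. *)
have pE : a * pochhammer (a + 1) n = pochhammer a n * (a + n%:R).
  by rewrite -pochhammerSl pochhammerS.
have pE' : pochhammer (a + 1) n = pochhammer a n * (a + n%:R) / a.
  by rewrite -pE mulrAC mulfV ?mul1r// gt_eqF.
rewrite IH Bn xan [in RHS]big_nat_recr; last by [].
rewrite pE' !pochhammerS.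
move: p0 (lt0r_neq0 an0).
move: (\sum_(0 <= _ < _) _) (beta_integral _ _ _) (pochhammer a n)
  (pochhammer (a + u) n) (x `^ a) (x ^+ n) (_ `^ u) => S B p q X Y Z p0.
rewrite -[a + u + n%:R](addrAC a).
move: (a + n%:R) => an ann0 /=; field.
by rewrite ann0 !gt_eqF.
Qed.

Lemma beta_integral_right1 (R : realType) (x a : R) : 0 < a -> 0 < x -> x < 1 ->
  beta_integral x a 1 = x `^ a / a.
Proof.
move=> a0 x0 x1; have := beta_integral_by_parts a0 (lexx 0) x0 x1.
rewrite add0r mul0r addr0 powRr0 mulr1 => <-.
by rewrite mulrAC mulfV ?mul1r// gt_eqF.
Qed.

(** The remainder [r n] is nonnegative and at most a constant times the n-th term [h n].
    Nonnegativity bounds the partial sums, so the series of nonnegative terms converges; hence its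
    terms, and with them the remainder, tend to 0. *)
Lemma beta_integral_hyp2F1 (R : realType) (x a u : R) :
  0 < a -> 1 <= u -> 0 < x -> x < 1 ->
  beta_integral x a u =
  x `^ a * (1 - x) `^ u / a * hyp2F1 1 (a + u) (a + 1) x.
Proof.
move=> a0 u1 x0 x1; have u0 : 0 < u := lt_le_trans ltr01 u1.
have au0 : 0 < a + u by rewrite addr_gt0.
have a10 : 0 < a + 1 by rewrite addr_gt0.
pose h n := pochhammer (a + u) n / pochhammer (a + 1) n * x ^+ n.
pose K := x `^ a * (1 - x) `^ u / a.
have K0 : 0 < K by rewrite divr_gt0// mulr_gt0// powR_gt0// subr_gt0.
have h0 n : 0 <= h n.
  by rewrite !mulr_ge0 ?invr_ge0 ?exprn_ge0 ?(ltW (pochhammer_gt0 _ _)) ?(ltW x0).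
pose r n := pochhammer (a + u) n / pochhammer a n * beta_integral x (a + n%:R) u.
have r0 n : 0 <= r n.
  by rewrite !mulr_ge0 ?beta_integral_ge0 ?invr_ge0 ?(ltW (pochhammer_gt0 _ _)).
have HB n : beta_integral x a u = K * series h n + r n.
  by rewrite (beta_integral_partial_sum n a0 u0 x0 x1).
(* Dropping (1-t)^(u-1) <= 1 leaves x^(a+n) / (a+n), and (a)_n (a+n) = a (a+1)_n reassembles
   [h n]. *)
have rh n : r n <= x `^ a / a * h n.
  have an0 : 0 < a + n%:R by rewrite ltr_wpDr.
  have := le_beta_integral an0 u1 (ltW x1).
  rewrite beta_integral_right1// powRD ?(gt_eqF x0) ?implybT//.
  rewrite powR_mulrn ?(ltW x0)// => H.
  have p0 := pochhammer_gt0 n a0.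
  apply: (le_trans (ler_wpM2l _ H)).
    by rewrite divr_ge0// ltW// pochhammer_gt0.
  rewrite le_eqVlt /h; apply/orP; left; apply/eqP.
  have pE : a * pochhammer (a + 1) n = pochhammer a n * (a + n%:R).
    by rewrite -pochhammerSl pochhammerS.
  have -> : pochhammer (a + 1) n = pochhammer a n * (a + n%:R) / a.
    by rewrite -pE mulrAC mulfV ?mul1r// gt_eqF.
  move: p0 an0.
  move: (a + n%:R) (pochhammer a n) (pochhammer (a + u) n) => an p q ? ?.
  by field; rewrite !gt_eqF.
have ch : cvgn (series h).
  apply: nondecreasing_is_cvgn.
    by apply: nondecreasing_series => *; exact: h0.
  exists (beta_integral x a u / K) => _ [n _ <-].
  by rewrite ler_pdivlMr// mulrC (HB n) lerDl.
have r_cvg : r n @[n --> \oo] --> 0.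
  apply: (@squeeze_cvgr _ _ _ _ (fun=> 0) (fun n => x `^ a / a * h n)).
  - by near=> n; rewrite r0 rh.
  - exact: cvg_cst.
  - suff : (x `^ a / a * h n : R) @[n --> \oo] --> (x `^ a / a * 0 : R).
      by rewrite mulr0.
    by apply: cvgM; [exact: cvg_cst|exact: cvg_series_cvg_0].
(* The upper parameter 1 contributes (1)_n = n!, which cancels the factorial. *)
have -> : hyp2F1 1 (a + u) (a + 1) x = limn (series h).
  rewrite /hyp2F1; congr (limn (series _)); apply/funext => n.
  have p1 := pochhammer_gt0 n a10.
  have f0 : 0 < n`!%:R :> R by rewrite ltr0n fact_gt0.
  rewrite pochhammer1 /h; congr (_ * _); move: p1 f0.
  move: (pochhammer (a + 1) n) (pochhammer _ n) (n`!%:R) => p q f ? ?.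
  by field; rewrite !gt_eqF.
have : (K * series h n + r n : R) @[n --> \oo] --> (K * limn (series h) + 0 : R).
  by apply: cvgD r_cvg; apply: cvgM ch; exact: cvg_cst.
under eq_fun do rewrite -HB.
move=> H; rewrite -/K -[RHS]addr0.
apply: (cvg_unique _ (cvg_cst _) H) => //.
Unshelve. all: by end_near. Qed.

(** * Cross differences and the telescoping sum *)

(** The shift to [v + 1] meets the condition that the second parameter be at least 1 in the series
    expansion. *)
Lemma regularized_beta_hyp2F1 (R : realType) (x a v : R) :
  0 < a -> 0 < v -> 0 < x -> x < 1 ->
  regularized_beta x a (v + 1) =
  x `^ a * (1 - x) `^ (v + 1) * ((a + v) * Gamma (a + v)
    / (Gamma (a + 1) * Gamma (v + 1))) * hyp2F1 1 (a + v + 1) (a + 1) x.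
Proof.
move=> a0 v0 x0 x1; have v1 : 1 <= v + 1 by rewrite lerDr ltW.
have av0 : 0 < a + v by rewrite addr_gt0.
rewrite /regularized_beta beta_integral_hyp2F1// beta_integral1E// ?addr_gt0//.
rewrite addrA !GammaS//.
have := Gamma_gt0 a0; have := Gamma_gt0 v0; have := Gamma_gt0 av0.
move: (Gamma a) (Gamma v) (Gamma (a + v)) (x `^ a) (_ `^ (v + 1)) (hyp2F1 _ _ _ _).
move=> Ga Gv Gav X Y F ? ? ?.
by field; rewrite !gt_eqF.
Qed.

Lemma regularized_beta_cross (R : realType) (x a u w : R) :
  0 < a -> 0 < u -> 0 < w -> 0 < x -> x < 1 ->
  regularized_beta x a (u + 1) * regularized_beta x a w
  - regularized_beta x a u * regularized_beta x a (w + 1) =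
  x `^ (2 * a) * (1 - x) `^ (u + w + 1) *
  (a * Gamma (a + u) * Gamma (a + w)
     / (Gamma (a + 1) ^+ 2 * Gamma (u + 1) * Gamma (w + 1)) *
   ((a + w) * hyp2F1 1 (a + w + 1) (a + 1) x
    - (a + u) * hyp2F1 1 (a + u + 1) (a + 1) x)).
Proof.
move=> a0 u0 w0 x0 x1.
have x1' : 0 < 1 - x by rewrite subr_gt0.
have xaE : x `^ (2 * a) = x `^ a * x `^ a.
  by rewrite mulr2n mulrDl mul1r powRD// (gt_eqF x0) implybT.
have yuwE : (1 - x) `^ (u + w + 1) = (1 - x) `^ u * (1 - x) `^ w * (1 - x).
  by rewrite !powRD ?(gt_eqF x1') ?implybT// powRr1 ?(ltW x1').
have yE (v : R) : (1 - x) `^ (v + 1) = (1 - x) `^ v * (1 - x).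
  by rewrite powRD ?(gt_eqF x1') ?implybT// powRr1 ?(ltW x1').
have Ga := Gamma_gt0 a0.
have Gu : 0 < Gamma (u + 1) by apply: Gamma_gt0; rewrite addr_gt0.
have Gw : 0 < Gamma (w + 1) by apply: Gamma_gt0; rewrite addr_gt0.
have := regularized_beta_step a0 w0 x0 x1; have := regularized_beta_step a0 u0 x0 x1.
have := regularized_beta_hyp2F1 a0 w0 x0 x1; have := regularized_beta_hyp2F1 a0 u0 x0 x1.
rewrite xaE yuwE !yE (GammaS a0).
move: (Gamma a) (Gamma (u + 1)) (Gamma (w + 1)) (Gamma (a + u)) (Gamma (a + w))
  (hyp2F1 _ (a + u + 1) _ _) (hyp2F1 _ (a + w + 1) _ _)
  (x `^ a) ((1 - x) `^ u) ((1 - x) `^ w) Ga Gu Gw.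
move: (regularized_beta x a u) (regularized_beta x a w)
  (regularized_beta x a (u + 1)) (regularized_beta x a (w + 1)).
move=> Iu Iw Iu1 Iw1 Ga Gu Gw Gau Gaw Fu Fw X Yu Yw Ga0 Gu0 Gw0 Hu Hw Su Sw.
(* Subtract and add [Iu1 * Iw1]: each product now pairs a one-step increment with a value at a
   raised parameter, and both share the power of x, the power of 1 - x and the Gamma coefficient. *)
rewrite (_ : Iu1 * Iw - Iu * Iw1 = (Iu1 - Iu) * Iw1 - (Iw1 - Iw) * Iu1); last by ring.
rewrite {1}Su {2}Sw [Iu + _]addrC [Iw + _]addrC !addrK Hu Hw.
by field; rewrite !gt_eqF.
Qed.

Theorem theorem4 (R : realType) (alpha : nat) (a b beta x : R)
    (halpha : (0 < alpha)%N) (ha : 0 < a) (hb : 0 < b) (hbeta : 0 < beta)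
    (hx0 : 0 < x) (hx1 : x < 1) :
  phi a b alpha%:R beta x
    / (x `^ (2 * a) * (1 - x) `^ (2 * b + alpha%:R + beta))
  = \sum_(j < alpha)
      (a * Gamma (a + b + j%:R) * Gamma (a + b + beta + alpha%:R - j%:R - 1)
       / (Gamma (a + 1) ^+ 2 * Gamma (b + j%:R + 1)
          * Gamma (b + beta + alpha%:R - j%:R))
       * Eterm a b beta alpha j x).
Proof.
(* The two second parameters keep a constant sum; [G alpha] and [G 0] are the two products in
   [phi]. *)
pose G (j : nat) := regularized_beta x a (b + j%:R)
  * regularized_beta x a (b + beta + alpha%:R - j%:R).
have phiE : phi a b alpha%:R beta x = \sum_(0 <= j < alpha) (G j.+1 - G j).
  rewrite telescope_sumr; last exact: ltnW.
  rewrite /phi /G addrK addr0 subr0.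
  by rewrite [b + beta + _]addrAC.
set W := x `^ (2 * a) * _.
have W0 : W != 0.
  by rewrite gt_eqF// mulr_gt0// powR_gt0// subr_gt0.
rewrite phiE mulr_suml big_mkord; apply: eq_bigr => j _.
pose u := b + j%:R; pose w := b + beta + alpha%:R - j%:R - 1.
have u0 : 0 < u by rewrite ltr_wpDr.
(* Since j + 1 <= alpha, [w] is at least b + beta. *)
have w0 : 0 < w.
  have : j.+1%:R <= alpha%:R :> R by rewrite ler_nat.
  by rewrite /w -natr1 => ja; lra.
apply: (mulIf W0); rewrite mulfVK// mulrC /G.
rewrite -natr1 addrA -/u [X in _ * regularized_beta x a X](_ : _ = w); last first.
  by rewrite /w; ring.
rewrite [X in _ - _ * regularized_beta x a X](_ : _ = w + 1); last by rewrite subrK.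
rewrite regularized_beta_cross// /W /Eterm.
(* This exponent does not depend on [j], so every summand carries the same factor [W]. *)
have -> : u + w + 1 = 2 * b + alpha%:R + beta by rewrite /u /w; ring.
have -> : a + b + j%:R = a + u by rewrite addrA.
have -> : a + b + beta + alpha%:R - j%:R - 1 = a + w by rewrite /w; ring.
have -> : a + b + beta + alpha%:R - j%:R = a + w + 1 by rewrite /w; ring.
by have -> : b + beta + alpha%:R - j%:R = w + 1 by rewrite /w subrK.
Qed.
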